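(* Let $F$ be any absolute, normalised norm on $\mathbb{R}^2$ with $F\neq\|\cdot\|_\infty$, and let $X$ and $Y$ be nontrivial real Banach spaces. Then the following holds: (i) If $X\oplus_F Y$ is LASQ, then $X$ and $Y$ are LASQ. (ii) If $X\oplus_F Y$ is WASQ, then $X$ and $Y$ are WASQ. (iii) $X\oplus_F Y$ is not ASQ.
   Context: All Banach spaces are real; nontrivial means $\neq\{0\}$. $B_X$ is the closed unit ball and $S_X$ the unit sphere of $X$. A norm $F$ on $\mathbb{R}^2$ is absolute if $F(a,b)=F(|a|,|b|)$ for all $(a,b)\in\mathbb{R}^2$, and normalised if $F(1,0)=F(0,1)=1$. For such an absolute, normalised norm $F$ and Banach spaces $X,Y$, the absolute sum $X\oplus_F Y$ is $X\times Y$ with the norm $\|(x,y)\|_F=F(\|x\|,\|y\|)$ (it is a Banach space). $\|\cdot\|_\infty$ is the maximum norm on $\mathbb{R}^2$. $X$ is almost square (ASQ) if for all $n\in\mathbb{N}$ and all $x_1,\dots,x_n\in S_X$ there is a sequence $(y_k)_{k\in\mathbb{N}}$ in $B_X$ such that $\|y_k\|\to 1$ and $\|x_i+y_k\|\to 1$ for all $i=1,\dots,n$. $X$ is locally almost square (LASQ) if for every $x\in S_X$ there is a sequence $(y_k)_{k\in\mathbb{N}}$ in $B_X$ such that $\|y_k\|\to 1$ and $\|x\pm y_k\|\to 1$ (for both signs). $X$ is weakly almost square (WASQ) if for every $x\in S_X$ there is a sequence $(y_k)_{k\in\mathbb{N}}$ in $B_X$ converging weakly to zero such that $\|y_k\|\to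 1$ and $\|x\pm y_k\|\to 1$ (for both signs). *)

(* Defs.v *)
From HB Require Import structures.
From mathcomp Require Import all_boot all_order all_algebra.
From mathcomp Require Import all_classical all_reals topology normedtype.
From mathcomp Require Import ring lra.

Set Implicit Arguments.
Unset Strict Implicit.
Unset Printing Implicit Defensive.

Import Order.TTheory GRing.Theory Num.Theory.
Import numFieldNormedType.Exports.

Local Open Scope classical_set_scope.
Local Open Scope ring_scope.

Definition is_norm (R : realType) (V : lmodType R) (N : V -> R) : Prop :=
  [/\ forall u v, N (u + v) <= N u + N v,
      forall (a : R) v, N (a *: v) = `|a| * N v
    & forall v, N v = 0 -> v = 0].

Definition absolute (R : realType) (F : R * R -> R) : Prop :=
  forall a b, F (a, b) = F (`|a|, `|b|).

Definition normalised (R : realType) (F : R * R -> R) : Prop :=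
  F (1, 0) = 1 /\ F (0, 1) = 1.

Definition max_norm (R : realType) (p : R * R) : R :=
  Num.max `|p.1| `|p.2|.

Record absNorm (R : realType) := AbsNorm {
  absNorm_fun :> R * R -> R;
  absNorm_is_norm : is_norm absNorm_fun;
  absNorm_absolute : absolute absNorm_fun;
  absNorm_normalised : normalised absNorm_fun
}.

Section absNorm_theory.
Variables (R : realType) (F : absNorm R).

Lemma absNormD (p q : R * R) : F (p + q) <= F p + F q.
Proof. by have [+ _ _] := absNorm_is_norm F; apply. Qed.

Lemma absNormZ (a : R) (p : R * R) : F (a *: p) = `|a| * F p.
Proof. by have [_ + _] := absNorm_is_norm F; apply. Qed.

Lemma absNorm_eq0 (p : R * R) : F p = 0 -> p = 0.
Proof. by have [_ _ +] := absNorm_is_norm F; apply. Qed.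

Lemma absNorm10 : F (1, 0) = 1.
Proof. by have [] := absNorm_normalised F. Qed.

Lemma absNorm01 : F (0, 1) = 1.
Proof. by have [] := absNorm_normalised F. Qed.

Lemma absNorm_abs a b : F (a, b) = F (`|a|, `|b|).
Proof. exact: absNorm_absolute. Qed.

Lemma absNorm_mono1 (a c b : R) : 0 <= a -> a <= c -> F (a, b) <= F (c, b).
Proof.
move=> a0 ac; have [c0|c0] := eqVneq c 0.
  have -> : a = 0 by lra.
  by rewrite c0.
have cp : 0 < c by rewrite lt_neqAle eq_sym c0 (le_trans a0).
pose t := a / c.
have t0 : 0 <= t by rewrite divr_ge0// ltW.
have t1 : t <= 1 by rewrite ler_pdivrMr// mul1r.
have -> : (a, b) = ((1 + t) / 2) *: (c, b) + ((1 - t) / 2) *: (- c, b).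
  by apply: injective_projections; rewrite /= /t /GRing.scale/=; field.
apply: le_trans (absNormD _ _) _; rewrite !absNormZ.
rewrite (absNorm_abs (- c)) normrN -absNorm_abs.
have -> : `|(1 + t) / 2| = (1 + t) / 2 by rewrite ger0_norm; lra.
have -> : `|(1 - t) / 2| = (1 - t) / 2 by rewrite ger0_norm; lra.
by rewrite le_eqVlt; apply/orP; left; apply/eqP; field.
Qed.

Lemma absNorm_mono2 (a b d : R) : 0 <= b -> b <= d -> F (a, b) <= F (a, d).
Proof.
move=> b0 bd; have [d0|d0] := eqVneq d 0.
  have -> : b = 0 by lra.
  by rewrite d0.
have dp : 0 < d by rewrite lt_neqAle eq_sym d0 (le_trans b0).
pose t := b / d.
have t0 : 0 <= t by rewrite divr_ge0// ltW.
have t1 : t <= 1 by rewrite ler_pdivrMr// mul1r.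
have -> : (a, b) = ((1 + t) / 2) *: (a, d) + ((1 - t) / 2) *: (a, - d).
  by apply: injective_projections; rewrite /= /t /GRing.scale/=; field.
apply: le_trans (absNormD _ _) _; rewrite !absNormZ.
rewrite (absNorm_abs _ (- d)) normrN -absNorm_abs.
have -> : `|(1 + t) / 2| = (1 + t) / 2 by rewrite ger0_norm; lra.
have -> : `|(1 - t) / 2| = (1 - t) / 2 by rewrite ger0_norm; lra.
by rewrite le_eqVlt; apply/orP; left; apply/eqP; field.
Qed.

Lemma absNorm_mono (a b c d : R) :
  0 <= a -> a <= c -> 0 <= b -> b <= d -> F (a, b) <= F (c, d).
Proof.
move=> a0 ac b0 bd.
exact: le_trans (absNorm_mono1 _ a0 ac) (absNorm_mono2 _ b0 bd).
Qed.

Lemma absNorm_axis1 a : F (a, 0) = `|a|.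
Proof.
have -> : (a, 0) = a *: ((1, 0) : R * R).
  by apply: injective_projections; rewrite /= /GRing.scale/= ?mulr1 ?mulr0.
by rewrite absNormZ absNorm10 mulr1.
Qed.

Lemma absNorm_axis2 b : F (0, b) = `|b|.
Proof.
have -> : (0, b) = b *: ((0, 1) : R * R).
  by apply: injective_projections; rewrite /= /GRing.scale/= ?mulr1 ?mulr0.
by rewrite absNormZ absNorm01 mulr1.
Qed.

Lemma absNorm_le_sum (a b : R) : F (a, b) <= `|a| + `|b|.
Proof.
rewrite -absNorm_axis1 -absNorm_axis2.
have -> : (a, b) = (a, 0) + (0, b) :> R * R.
  by apply: injective_projections; rewrite /= ?addr0 ?add0r.
exact: absNormD.
Qed.

Lemma absNorm_ge1 (a b : R) : `|a| <= F (a, b).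
Proof.
rewrite -(normr_id a) -absNorm_axis1 (absNorm_abs a b).
exact: absNorm_mono.
Qed.

Lemma absNorm_ge2 (a b : R) : `|b| <= F (a, b).
Proof.
rewrite -(normr_id b) -absNorm_axis2 (absNorm_abs a b).
exact: absNorm_mono.
Qed.

End absNorm_theory.

(* An alias of X * Y, so that it does not inherit the library's maximum norm
   on products. *)
Definition absSum (R : realType) (F : absNorm R) (X Y : normedModType R) : Type :=
  (X * Y)%type.

Section absSum_normed.
Variables (R : realType) (F : absNorm R) (X Y : normedModType R).

HB.instance Definition _ := GRing.Lmodule.copy (absSum F X Y) (X * Y)%type.

Definition absSum_norm (z : absSum F X Y) : R := F (`|z.1|, `|z.2|).

Lemma absSum_normD (z w : absSum F X Y) :
  absSum_norm (z + w) <= absSum_norm z + absSum_norm w.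
Proof.
rewrite /absSum_norm; apply: le_trans (absNormD F _ _).
by apply: absNorm_mono => //=; exact: ler_normD.
Qed.

Lemma absSum_normZ (a : R) (z : absSum F X Y) :
  absSum_norm (a *: z) = `|a| * absSum_norm z.
Proof.
rewrite /absSum_norm /= !normrZ.
have -> : (`|a| * `|z.1|, `|a| * `|z.2|) = `|a| *: ((`|z.1|, `|z.2|) : R * R).
  by [].
by rewrite absNormZ normr_id.
Qed.

Lemma absSum_norm_eq0 (z : absSum F X Y) : absSum_norm z = 0 -> z = 0.
Proof.
case: z => x y /absNorm_eq0 /pair_equal_spec[/normr0_eq0/= -> /normr0_eq0/= ->].
by [].
Qed.

HB.instance Definition _ := @Lmodule_isNormed.Build R (absSum F X Y)
  absSum_norm absSum_normD absSum_normZ absSum_norm_eq0.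

End absSum_normed.

Lemma absSum_normE (R : realType) (F : absNorm R) (X Y : normedModType R)
  (z : absSum F X Y) : `|z| = F (`|z.1|, `|z.2|).
Proof. by []. Qed.

Section absSum_complete.
Variables (R : realType) (F : absNorm R) (X Y : completeNormedModType R).

Lemma absSum_cauchy_cvg (G : set_system (absSum F X Y)) :
  ProperFilter G -> cauchy G -> cvg G.
Proof.
move=> GG /cauchy_ballP Gc.
have c1 : cvg ((fst : absSum F X Y -> X) @ G).
  apply: cauchy_cvg; apply/cauchy_ballP => e e0.
  rewrite near_map2; apply: filterS (Gc _ e0) => -[z w] /=.
  rewrite -!ball_normE /=; apply: le_lt_trans.
  by rewrite absSum_normE -[leLHS]normr_id; exact: absNorm_ge1.
have c2 : cvg ((snd : absSum F X Y -> Y) @ G).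
  apply: cauchy_cvg; apply/cauchy_ballP => e e0.
  rewrite near_map2; apply: filterS (Gc _ e0) => -[z w] /=.
  rewrite -!ball_normE /=; apply: le_lt_trans.
  by rewrite absSum_normE -[leLHS]normr_id; exact: absNorm_ge2.
move/cvg_ex: c1 => [x /cvgrPdist_lt Gx]; move/cvg_ex: c2 => [y /cvgrPdist_lt Gy].
apply/cvg_ex; exists ((x, y) : absSum F X Y).
apply/cvgrPdist_lt => e e0; have e20 : 0 < e / 2 by lra.
apply: filterS2 (Gx _ e20) (Gy _ e20) => z zx zy.
rewrite absSum_normE /=; apply: le_lt_trans (absNorm_le_sum F _ _) _.
by rewrite !normr_id; lra.
Qed.

HB.instance Definition _ :=
  Uniform_isComplete.Build (absSum F X Y) absSum_cauchy_cvg.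

End absSum_complete.

Definition weakly_null (R : realType) (X : normedModType R) (y : nat -> X) :=
  forall f : {linear X -> R}, continuous f -> f (y k) @[k --> \oo] --> (0 : R).

Definition nontrivial (R : realType) (X : normedModType R) : Prop :=
  exists x : X, x != 0.

Definition ASQ (R : realType) (X : normedModType R) : Prop :=
  forall (n : nat) (x : 'I_n -> X), (0 < n)%N -> (forall i, `|x i| = 1) ->
  exists y : nat -> X,
    [/\ forall k, `|y k| <= 1,
        `|y k| @[k --> \oo] --> (1 : R)
      & forall i, `|x i + y k| @[k --> \oo] --> (1 : R)].

Definition LASQ (R : realType) (X : normedModType R) : Prop :=
  forall x : X, `|x| = 1 ->
  exists y : nat -> X,
    [/\ forall k, `|y k| <= 1,
        `|y k| @[k --> \oo] --> (1 : R),
        `|x + y k| @[k --> \oo] --> (1 : R)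
      & `|x - y k| @[k --> \oo] --> (1 : R)].

Definition WASQ (R : realType) (X : normedModType R) : Prop :=
  forall x : X, `|x| = 1 ->
  exists y : nat -> X,
    [/\ forall k, `|y k| <= 1,
        weakly_null y,
        `|y k| @[k --> \oo] --> (1 : R),
        `|x + y k| @[k --> \oo] --> (1 : R)
      & `|x - y k| @[k --> \oo] --> (1 : R)].

(* Main.v *)
Require Import Defs.
From HB Require Import structures.
From mathcomp Require Import all_boot all_order all_algebra.
From mathcomp Require Import all_classical all_reals topology normedtype.
From mathcomp Require Import lra.

(** Among absolute normalised norms the maximum norm is singled out by
    [F (1, 1) = 1], so the hypothesis on [F] is that the gap
    [c = F (1, 1) - 1] is positive.  The proof rests on one inequality: if
    [|x| = 1] and [z = (u, v)] lies in the unit ball of the sum, then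
      [c * (1 - |u|) <= (1 - |z|) + (|(x, 0) + z| - 1) + (|(x, 0) - z| - 1)].
    Thus any [z] that is almost of norm one and almost square to [(x, 0)]
    must have a first coordinate of norm almost one.  The geometric reason is
    that [b = |v|] satisfies [F (1, b) ~ 1], hence stays away from [1]; then
    [(a, b) = a (1, b) + b (1 - a) (0, 1)] exhibits [(a, b)], [a = |u|], as a
    combination of (almost) ball points with total weight
    [1 - (1 - a) (1 - b)], so that [F (a, b) ~ 1] forces [a ~ 1].

    For LASQ and WASQ, the first coordinates of the sequence that witnesses the
    property at [(x, 0)] therefore witness it at [x] : their norms tend to one
    by the inequality, the norms [|x + u|] and [|x - u|] are at most those of
    [(x, 0) + z] and [(x, 0) - z] and have sum at least [2], and coordinate
    projections preserve weak convergence.  The second summand is treated by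
    exchanging the two coordinates of [F].  If the sum were ASQ, a single
    sequence would work for [(x, 0)], [(- x, 0)], [(0, y)] and [(0, - y)]; both
    coordinates of its terms would have norms tending to one while the terms
    stay in the unit ball, giving [F (1, 1) <= 1]. *)

Set Implicit Arguments.
Unset Strict Implicit.
Unset Printing Implicit Defensive.

Import Order.TTheory GRing.Theory Num.Theory.
Import numFieldNormedType.Exports.

Local Open Scope classical_set_scope.
Local Open Scope ring_scope.

(** * Absolute norms on the plane *)

Section absNorm_plane.
Variables (R : realType).
Implicit Types F : absNorm R.

(** Since [F (a, b) <= max |a| |b| * F (1, 1)] by monotonicity, the value at
    [(1, 1)] alone decides whether [F] is the maximum norm. *)
Lemma absNorm11_gt1 F : absNorm_fun F <> @max_norm R -> 1 < F (1, 1).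
Proof.
move=> Fmax; rewrite ltNge; apply/negP => F11; apply: Fmax.
apply/funext => -[a b]; rewrite /max_norm /=; apply/eqP; rewrite eq_le.
apply/andP; split; last by rewrite ge_max absNorm_ge1 absNorm_ge2.
set m := Num.max _ _.
have am : `|a| <= m by rewrite /m le_max lexx.
have bm : `|b| <= m by rewrite /m le_max lexx orbT.
have m0 : 0 <= m by exact: le_trans (normr_ge0 a) am.
rewrite absNorm_abs; apply: le_trans (_ : F (m, m) <= _).
  exact: absNorm_mono.
have -> : (m, m) = m *: ((1, 1) : R * R).
  by apply: injective_projections; rewrite /= /GRing.scale/= mulr1.
by rewrite absNormZ ger0_norm// -[leRHS]mulr1 ler_wpM2l.
Qed.

Lemma absNorm11_le F (a b : R) :
  a <= 1 -> b <= 1 -> F (1, 1) <= F (a, b) + (1 - a) + (1 - b).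
Proof.
move=> a1 b1.
have {1}-> : (1, 1) = (a, b) + (1 - a, 1 - b) :> R * R.
  by apply: injective_projections => /=; lra.
rewrite -addrA; apply: le_trans (absNormD _ _ _) _; rewrite lerD2l.
by apply: le_trans (absNorm_le_sum _ _ _) _; rewrite !ger0_norm; lra.
Qed.

(** Quantitative form of: if [F (1, b) = 1] and [F (a, b) = 1] then [a = 1].
    It combines [(1 - a) (1 - b) <= (1 - F (a, b)) + (F (1, b) - 1)] with
    [1 - b >= F (1, 1) - F (1, b)]. *)
Lemma absNorm_gap F (a b : R) : 0 <= a <= 1 -> 0 <= b <= 1 ->
  (F (1, 1) - 1) * (1 - a) <= (1 - F (a, b)) + 2 * (F (1, b) - 1).
Proof.
move=> /andP[a0 a1] /andP[b0 b1].
have F1b : 1 <= F (1, b) by have := absNorm_ge1 F 1 b; rewrite normr1.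
have Fab : F (a, b) <= a * F (1, b) + b * (1 - a).
  have ba0 : 0 <= b * (1 - a) by rewrite mulr_ge0// subr_ge0.
  have {1}-> : (a, b) = a *: ((1, b) : R * R) + (0, b * (1 - a)).
    by apply: injective_projections; rewrite /= /GRing.scale/=; lra.
  apply: le_trans (absNormD _ _ _) _.
  by rewrite absNormZ absNorm_axis2 !ger0_norm.
have F11 : F (1, 1) <= F (1, b) + (1 - b).
  by have := absNorm11_le F (lexx 1) b1; rewrite subrr addr0.
have := ler_wpM2r (_ : 0 <= 1 - a) F11; rewrite subr_ge0 => /(_ a1).
have := mulr_ge0 a0 (_ : 0 <= F (1, b) - 1); rewrite subr_ge0 => /(_ F1b).
lra.
Qed.

Section swap.
Variable F : absNorm R.

(** [absSum F X Y] with its summands exchanged is the sum for this norm, which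
    transfers estimates from the first coordinate to the second. *)
Definition swap_fun (p : R * R) : R := F (p.2, p.1).

Lemma swap_is_norm : is_norm swap_fun.
Proof.
split=> [u v|a v|[a b]]; rewrite /swap_fun.
- exact: (absNormD F (u.2, u.1) (v.2, v.1)).
- exact: (absNormZ F a (v.2, v.1)).
- by move=> /absNorm_eq0[/= -> ->].
Qed.

Lemma swap_absolute : absolute swap_fun.
Proof. by move=> a b; rewrite /swap_fun /= absNorm_abs. Qed.

Lemma swap_normalised : normalised swap_fun.
Proof. by rewrite /normalised /swap_fun /= absNorm01 absNorm10. Qed.

Definition absNorm_swap : absNorm R :=
  AbsNorm swap_is_norm swap_absolute swap_normalised.

End swap.

(** Here [s] and [d] stand for the norms of [x + u] and [x - u] with [|x| = 1],
    which bound [2] by the triangle inequality; averaging the values of [F] at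
    [(s, b)] and [(d, b)] controls [F (1, b)]. *)
Lemma absNorm_square_gap F (a b s d : R) :
  0 <= a -> 0 <= b -> 0 <= s -> 0 <= d -> 2 <= s + d -> F (a, b) <= 1 ->
  (F (1, 1) - 1) * (1 - a) <=
    (1 - F (a, b)) + (F (s, b) - 1) + (F (d, b) - 1).
Proof.
move=> a0 b0 s0 d0 sd Fab.
have a1 : 0 <= a <= 1.
  by have := absNorm_ge1 F a b; rewrite ger0_norm//; lra.
have b1 : 0 <= b <= 1.
  by have := absNorm_ge2 F a b; rewrite ger0_norm//; lra.
have := absNorm_gap F a1 b1.
suff : 2 * F (1, b) <= F (s, b) + F (d, b) by lra.
apply: le_trans (absNormD _ _ _).
have -> : 2 * F (1, b) = F (2, 2 * b).
  have -> : (2, 2 * b) = 2 *: ((1, b) : R * R).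
    by apply: injective_projections; rewrite /= /GRing.scale/= ?mulr1.
  by rewrite absNormZ ger0_norm.
by apply: absNorm_mono => //=; lra.
Qed.

End absNorm_plane.

(** * Square sequences and norm-one complemented summands *)

Lemma norm_shift_sum (R : realType) (V : normedModType R) (x u : V) :
  `|x| = 1 -> 2 <= `|x + u| + `|x - u|.
Proof.
move=> x1; apply: le_trans (ler_normD _ _).
by rewrite addrACA subrr addr0 -mulr2n normrMn x1.
Qed.

(** The two coordinate projections of an absolute sum are handled at once:
    [i] is an embedding of [X] in [Z], [p] a contractive retraction of it, and
    [square_gap] says that vectors of [Z] of norm almost one that are almost
    square to [i x] lose almost no norm under [p]. *)
Section summand.
Variables (R : realType) (Z X : normedModType R).
Variables (i : X -> Z) (p : {linear Z -> X}) (c : R).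
Hypothesis c_gt0 : 0 < c.
Hypothesis i_norm : forall x, `|i x| = `|x|.
Hypothesis iK : cancel i p.
Hypothesis p_le : forall z, `|p z| <= `|z|.
Hypothesis square_gap : forall x z, `|x| = 1 -> `|z| <= 1 ->
  c * (1 - `|p z|) <= (1 - `|z|) + (`|i x + z| - 1) + (`|i x - z| - 1).

Lemma summand_cvg_norm (x : X) (z : nat -> Z) : `|x| = 1 ->
  (forall k, `|z k| <= 1) -> `|z k| @[k --> \oo] --> (1 : R) ->
  `|i x + z k| @[k --> \oo] --> (1 : R) ->
  `|i x - z k| @[k --> \oo] --> (1 : R) ->
  `|p (z k)| @[k --> \oo] --> (1 : R).
Proof.
move=> x1 z1 zc sc dc.
apply: (@squeeze_cvgr _ _ _ _ (fun k => 1 - c^-1 *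
  ((1 - `|z k|) + (`|i x + z k| - 1) + (`|i x - z k| - 1))) (fun=> 1)).
- near=> k; rewrite (le_trans (p_le _) (z1 k)) andbT lerBlDr -lerBlDl.
  by rewrite ler_pdivlMl//; exact: square_gap.
- rewrite -[X in _ --> X](_ : 1 - c^-1 * ((1 - 1) + (1 - 1) + (1 - 1)) = 1).
    apply: cvgB; first exact: cvg_cst.
    apply: cvgM; first exact: cvg_cst.
    apply: cvgD; last by apply: cvgB => //; exact: cvg_cst.
    by apply: cvgD; apply: cvgB => //; exact: cvg_cst.
  by rewrite subrr !addr0 mulr0 subr0.
- exact: cvg_cst.
Unshelve. all: by end_near. Qed.

(** The upper bound is contractivity of [p]; the lower bound holds because
    [|x + u| + |x - u| >= 2]. *)
Lemma summand_cvg_shift (x : X) (z : nat -> Z) : `|x| = 1 ->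
  `|i x + z k| @[k --> \oo] --> (1 : R) ->
  `|i x - z k| @[k --> \oo] --> (1 : R) ->
  `|x + p (z k)| @[k --> \oo] --> (1 : R).
Proof.
move=> x1 sc dc.
apply: (@squeeze_cvgr _ _ _ _ (fun k => 2 - `|i x - z k|)
  (fun k => `|i x + z k|)) => //; last first.
  rewrite -[X in _ --> X](_ : 2 - 1 = 1); last by lra.
  by apply: cvgB => //; exact: cvg_cst.
near=> k.
have s_le : `|x + p (z k)| <= `|i x + z k|.
  by rewrite -{1}(iK x) -linearD; exact: p_le.
have d_le : `|x - p (z k)| <= `|i x - z k|.
  by rewrite -{1}(iK x) -linearB; exact: p_le.
have := norm_shift_sum (p (z k)) x1.
by rewrite s_le andbT; lra.
Unshelve. all: by end_near. Qed.

Lemma summand_cvg_shiftN (x : X) (z : nat -> Z) : `|x| = 1 ->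
  `|i x + z k| @[k --> \oo] --> (1 : R) ->
  `|i x - z k| @[k --> \oo] --> (1 : R) ->
  `|x - p (z k)| @[k --> \oo] --> (1 : R).
Proof.
move=> x1 sc dc.
have -> : (fun k => `|x - p (z k)|) = (fun k => `|x + p (- z k)|).
  by apply/funext => k; rewrite linearN.
apply: summand_cvg_shift => //.
by under eq_fun do rewrite opprK.
Qed.

Lemma summand_LASQ : LASQ Z -> LASQ X.
Proof.
move=> ZL x x1; have [|z [z1 zc sc dc]] := ZL (i x); first by rewrite i_norm.
exists (p \o z); split.
- by move=> k; exact: le_trans (p_le _) (z1 k).
- exact: summand_cvg_norm x1 z1 zc sc dc.
- exact: summand_cvg_shift.
- exact: summand_cvg_shiftN.
Qed.

Lemma contraction_continuous : continuous p.
Proof.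
move=> z; apply/cvgrPdist_lt => e e0; near=> w.
rewrite -linearB; apply: le_lt_trans (p_le _) _.
near: w; exact: cvgr_dist_lt.
Unshelve. all: by end_near. Qed.

(** A functional [f] on [X] pulls back to the functional [f \o p] on [Z]. *)
Lemma contraction_weakly_null (z : nat -> Z) :
  weakly_null z -> weakly_null (p \o z).
Proof.
move=> zw f fc; have := zw (f \o p : {linear Z -> R}); apply => w.
by apply: continuous_comp; [exact: contraction_continuous|exact: fc].
Qed.

Lemma summand_WASQ : WASQ Z -> WASQ X.
Proof.
move=> ZW x x1; have [|z [z1 zw zc sc dc]] := ZW (i x); first by rewrite i_norm.
exists (p \o z); split.
- by move=> k; exact: le_trans (p_le _) (z1 k).
- exact: contraction_weakly_null.
- exact: summand_cvg_norm x1 z1 zc sc dc.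
- exact: summand_cvg_shift.
- exact: summand_cvg_shiftN.
Qed.

End summand.

(** * The two coordinates of an absolute sum *)

Section absSum_coordinates.
Variables (R : realType) (F : absNorm R) (X Y : normedModType R).
Let Z := absSum F X Y.

Definition absSum_inl (x : X) : Z := (x, 0).
Definition absSum_inr (y : Y) : Z := (0, y).
Definition absSum_fst (z : Z) : X := z.1.
Definition absSum_snd (z : Z) : Y := z.2.

Lemma absSum_fst_linear : linear absSum_fst. Proof. by []. Qed.
Lemma absSum_snd_linear : linear absSum_snd. Proof. by []. Qed.

HB.instance Definition _ :=
  GRing.isLinear.Build R Z X _ absSum_fst absSum_fst_linear.
HB.instance Definition _ :=
  GRing.isLinear.Build R Z Y _ absSum_snd absSum_snd_linear.

Lemma norm_absSum_inl x : `|absSum_inl x| = `|x|.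
Proof. by rewrite absSum_normE /= normr0 absNorm_axis1 normr_id. Qed.

Lemma norm_absSum_inr y : `|absSum_inr y| = `|y|.
Proof. by rewrite absSum_normE /= normr0 absNorm_axis2 normr_id. Qed.

Lemma norm_absSum_fst z : `|absSum_fst z| <= `|z|.
Proof. by rewrite absSum_normE -[leLHS]normr_id; exact: absNorm_ge1. Qed.

Lemma norm_absSum_snd z : `|absSum_snd z| <= `|z|.
Proof. by rewrite absSum_normE -[leLHS]normr_id; exact: absNorm_ge2. Qed.

Lemma absSum_inl_square_gap (x : X) (z : Z) : `|x| = 1 -> `|z| <= 1 ->
  (F (1, 1) - 1) * (1 - `|absSum_fst z|) <=
  (1 - `|z|) + (`|absSum_inl x + z| - 1) + (`|absSum_inl x - z| - 1).
Proof.
move=> x1 z1; rewrite !absSum_normE /= !add0r normrN.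
by apply: absNorm_square_gap => //; exact: norm_shift_sum.
Qed.

Lemma absSum_inr_square_gap (y : Y) (z : Z) : `|y| = 1 -> `|z| <= 1 ->
  (F (1, 1) - 1) * (1 - `|absSum_snd z|) <=
  (1 - `|z|) + (`|absSum_inr y + z| - 1) + (`|absSum_inr y - z| - 1).
Proof.
move=> y1 z1; rewrite !absSum_normE /= !add0r normrN.
apply: (@absNorm_square_gap _ (absNorm_swap F) `|z.2| `|z.1|
  `|y + z.2| `|y - z.2|) => //.
exact: norm_shift_sum.
Qed.

End absSum_coordinates.

Lemma nontrivial_unit_vector (R : realType) (X : normedModType R) :
  nontrivial X -> exists x : X, `|x| = 1.
Proof.
move=> [x x0]; exists (`|x|^-1 *: x).
by rewrite normrZ normfV normr_id mulVf// normr_eq0.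
Qed.

(** The definition of ASQ asks for [|x + y k|] only, so both signs of each
    vector are put in the family in order to apply the square-gap estimates. *)
Lemma absSum_not_ASQ (R : realType) (F : absNorm R) (X Y : normedModType R) :
  1 < F (1, 1) -> nontrivial X -> nontrivial Y -> ~ ASQ (absSum F X Y).
Proof.
move=> F11 /nontrivial_unit_vector[x x1] /nontrivial_unit_vector[y y1] A.
have c0 : 0 < F (1, 1) - 1 by rewrite subr_gt0.
pose X' := absSum_inl F Y x; pose Y' := absSum_inr F X y.
pose w (j : 'I_4) : absSum F X Y := nth 0 [:: X'; - X'; Y'; - Y'] j.
have [//||z [z1 zc wc]] := A 4 w.
  case=> -[|[|[|[|//]]]] ?;
    by rewrite /w /= ?normrN ?norm_absSum_inl ?norm_absSum_inr.
have flip (v : absSum F X Y) : `|- v + z k| @[k --> \oo] --> (1 : R) ->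
    `|v - z k| @[k --> \oo] --> (1 : R).
  by under eq_fun do rewrite addrC distrC.
have Xc : `|absSum_fst (z k)| @[k --> \oo] --> (1 : R).
  apply: (summand_cvg_norm c0 (@norm_absSum_fst _ F X Y)
    (@absSum_inl_square_gap _ F X Y) x1 z1 zc).
  - exact: (wc (@Ordinal 4 0 isT)).
  - by apply: flip; exact: (wc (@Ordinal 4 1 isT)).
have Yc : `|absSum_snd (z k)| @[k --> \oo] --> (1 : R).
  apply: (summand_cvg_norm c0 (@norm_absSum_snd _ F X Y)
    (@absSum_inr_square_gap _ F X Y) y1 z1 zc).
  - exact: (wc (@Ordinal 4 2 isT)).
  - by apply: flip; exact: (wc (@Ordinal 4 3 isT)).
have XYc : `|absSum_fst (z k)| + `|absSum_snd (z k)| @[k --> \oo] --> (2 : R).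
  by rewrite -[X in _ --> X](_ : 1 + 1 = 2) //; exact: cvgD.
have : F (1, 1) <= 1.
  (* In the unit ball [|u| + |v| <= 3 - F (1, 1)]; the left side tends to 2. *)
  suff : 2 <= 3 - F (1, 1) by lra.
  rewrite -(cvg_lim _ XYc)//; apply: limr_le; first by apply/cvg_ex; exists 2.
  near=> k.
  have := absNorm11_le F (le_trans (norm_absSum_fst (z k)) (z1 k))
    (le_trans (norm_absSum_snd (z k)) (z1 k)).
  have := z1 k; rewrite absSum_normE /absSum_fst /absSum_snd; lra.
by rewrite leNgt F11.
Unshelve. all: by end_near. Qed.

Theorem proposition2p3 (R : realType) (F : absNorm R)
    (X Y : completeNormedModType R)
    (hF : absNorm_fun F <> @max_norm R)
    (hX : nontrivial X) (hY : nontrivial Y) :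
  [/\ LASQ (absSum F X Y) -> LASQ X /\ LASQ Y,
      WASQ (absSum F X Y) -> WASQ X /\ WASQ Y
    & ~ ASQ (absSum F X Y)].
Proof.
have F11 := absNorm11_gt1 hF.
have c0 : 0 < F (1, 1) - 1 by rewrite subr_gt0.
have lK : cancel (@absSum_inl _ F X Y) (@absSum_fst _ F X Y) by [].
have rK : cancel (@absSum_inr _ F X Y) (@absSum_snd _ F X Y) by [].
split.
- move=> Z; split.
  + exact: (summand_LASQ c0 (@norm_absSum_inl _ F X Y) lK
      (@norm_absSum_fst _ F X Y) (@absSum_inl_square_gap _ F X Y) Z).
  + exact: (summand_LASQ c0 (@norm_absSum_inr _ F X Y) rK
      (@norm_absSum_snd _ F X Y) (@absSum_inr_square_gap _ F X Y) Z).
- move=> Z; split.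
  + exact: (summand_WASQ c0 (@norm_absSum_inl _ F X Y) lK
      (@norm_absSum_fst _ F X Y) (@absSum_inl_square_gap _ F X Y) Z).
  + exact: (summand_WASQ c0 (@norm_absSum_inr _ F X Y) rK
      (@norm_absSum_snd _ F X Y) (@absSum_inr_square_gap _ F X Y) Z).
- exact: absSum_not_ASQ.
Qed.
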